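(* Let $A=(\mathbf{a}_1,\ldots,\mathbf{a}_n)\in\mathbb{X}^{m\times n}$ be a column regular matrix, $\mathcal{A}=\operatorname{span}\{\mathbf{a}_1,\ldots,\mathbf{a}_n\}$, let $\mathbf{d}\in\mathbb{X}^m$ be any vector with $\mathbf{d}\neq\mathbf{0}$ such that $A$ is consistent with $\mathbf{d}$, and let $\Delta=\Delta_A(\mathbf{d})$. Then $$\rho(\mathcal{A},\mathbf{d})=\min_{\mathbf{x}\in\mathbb{X}_+^n}\rho(A\mathbf{x},\mathbf{d})=\Delta,$$ where the minimum is attained at $\mathbf{x}=\Delta(\mathbf{d}^-A)^-$.
   Context: $\langle\mathbb{X},\mathbf{0},\mathbf{1},\oplus,\otimes\rangle$ is a linearly ordered radicable idempotent semifield: a commutative semiring with zero $\mathbf{0}$ and identity $\mathbf{1}$ in which $x\oplus x=x$ for all $x$, every nonzero $x$ has a multiplicative inverse $x^{-1}$, the power $x^q$ is defined for every nonzero $x$ and rational $q$, and the relation $x\le y\iff x\oplus y=y$ is a linear order. The sign $\otimes$ is omitted. $\mathbb{X}$ includes (or is extended by) a maximal element $\infty$, so that $x\le\infty$ for all $x\in\mathbb{X}$. All inequalities and minima refer to this order. $\mathbb{X}_+=\mathbb{X}\setminus\{\mathbf{0}\}$. Vector and matrix operations over $\mathbb{X}$ follow the usual rules with $\oplus,\otimes$ in place of $+,\times$. The zero vector is also denoted $\mathbf{0}$. For a column (row) vector $\mathbf{x}=(x_i)$, $\mathbf{x}^-$ is the row (column) vector with components $x_i^-=x_i^{-1}$ if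 $x_i\neq\mathbf{0}$ and $x_i^-=\mathbf{0}$ otherwise. A matrix is row (column) regular if it has no zero rows (columns). $\operatorname{span}\{\mathbf{a}_1,\ldots,\mathbf{a}_n\}=\{x_1\mathbf{a}_1\oplus\cdots\oplus x_n\mathbf{a}_n: x_i\in\mathbb{X}\}$. Distance: $\operatorname{supp}(\mathbf{a})=\{i: a_i\neq\mathbf{0}\}$; for nonzero vectors with $\operatorname{supp}(\mathbf{a})=\operatorname{supp}(\mathbf{b})$, $\rho(\mathbf{a},\mathbf{b})=\mathbf{b}^-\mathbf{a}\oplus\mathbf{a}^-\mathbf{b}$; $\rho(\mathbf{a},\mathbf{b})=\infty$ if the supports differ; $\rho(\mathbf{0},\mathbf{0})=\mathbf{1}$. $\rho(\mathcal{A},\mathbf{d})=\min_{\mathbf{a}\in\mathcal{A}}\rho(\mathbf{a},\mathbf{d})$. Consistency: let $I=\{i: d_i=\mathbf{0}\}$ and $J=\{j: a_{ij}>\mathbf{0}\text{ for some } i\in I\}$. $A=(a_{ij})$ is consistent with $\mathbf{d}$ if $a_{ij}=\mathbf{0}$ whenever $i\notin I$ and $j\in J$. Residual: for consistent $A$ and $\mathbf{d}$, $\Delta_A(\mathbf{d})=\big((A(\mathbf{d}^-A)^-)^-\mathbf{d}\big)^{1/2}$ if $A$ is row regular, and $\Delta_A(\mathbf{d})=\infty$ otherwise.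
   Formalization: Two false corner cases are mended: if A is not row regular, some zero row i must have d_i ≠ 0 (else Δ = ∞ but the distance is finite); the minimum over vectors with all entries nonzero is claimed only if d has no zero entries or Δ = ∞, and otherwise over nonzero x. *)

(* Defs.v *)
From HB Require Import structures.
From mathcomp Require Import all_boot all_order all_algebra.

Set Implicit Arguments.
Unset Strict Implicit.
Unset Printing Implicit Defensive.

Import Order.TTheory GRing.Theory.
Local Open Scope ring_scope.

(* The order of an additively written idempotent semigroup. *)
Definition sle (V : nmodType) (x y : V) : bool := x + y == y.
Definition slt (V : nmodType) (x y : V) : bool := (x != y) && sle x y.

(* [+%R] is the idempotent addition, [*%R] the multiplication.  The values
   of [sinv] and [spow] at 0 are irrelevant.  The exponent laws determine
   [spow]: roots are unique in a linearly ordered group.  The order is given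
   by [sle] and not by an [orderType] instance, because a structure joining
   [Order.Total] with a semiring is rejected next to [Num.POrderedZmodule]. *)
HB.mixin Record isRadicableSemifield X of GRing.ComNzSemiRing X := {
  saddxx : forall x : X, x + x = x;
  sle_total : total (@sle X);
  sinv : X -> X;
  smulVx : forall x : X, x != 0 -> sinv x * x = 1;
  spow : X -> rat -> X;
  spow1 : forall x : X, x != 0 -> spow x 1 = x;
  spowD : forall (x : X) (p q : rat),
    x != 0 -> spow x (p + q) = spow x p * spow x q;
  spowM : forall (x : X) (p q : rat),
    x != 0 -> spow x (p * q) = spow (spow x p) q;
}.

#[short(type="radicableSemifieldType")]
HB.structure Definition RadicableSemifield :=
  {X of isRadicableSemifield X & GRing.ComNzSemiRing X}.

(* The extension of a semifield by a maximal element.  The new element is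
   always fresh: a semifield with a largest element is {0, 1}, because the
   inverses of its nonzero elements are bounded as well. *)
Inductive withtop (T : Type) : Type := Fin of T | Infty.
Arguments Fin {T} _.
Arguments Infty {T}.

Section WithTopChoice.
Variable T : choiceType.

Definition option_of_withtop (x : withtop T) : option T :=
  if x is Fin a then Some a else None.
Definition withtop_of_option (x : option T) : withtop T :=
  if x is Some a then Fin a else Infty.
Lemma option_of_withtopK : cancel option_of_withtop withtop_of_option.
Proof. by case. Qed.

HB.instance Definition _ :=
  Choice.copy (withtop T) (can_type option_of_withtopK).
End WithTopChoice.

Section WithTop.
Variable X : radicableSemifieldType.
Implicit Types (a b : X) (x y z : withtop X).

Definition wadd x y : withtop X :=
  if x is Fin a then (if y is Fin b then Fin (a + b) else Infty) else Infty.

Definition wmul x y : withtop X :=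
  match x, y with
  | Fin a, Fin b => Fin (a * b)
  | Fin a, Infty => if a == 0 then Fin 0 else Infty
  | Infty, Fin b => if b == 0 then Fin 0 else Infty
  | Infty, Infty => Infty
  end.

Lemma sadd_eq0 a b : (a + b == 0) = (a == 0) && (b == 0).
Proof.
apply/eqP/andP => [ab0|[/eqP-> /eqP->]]; last by rewrite addr0.
split; apply/eqP; first by rewrite -[a]addr0 -ab0 addrA saddxx.
by rewrite -[b]add0r -ab0 -addrA saddxx.
Qed.

Lemma smul_eq0 a b : (a * b == 0) = (a == 0) || (b == 0).
Proof.
case: (eqVneq a 0) => [->|a0] /=; first by rewrite mul0r eqxx.
apply/eqP/eqP => [ab0|->]; last by rewrite mulr0.
by rewrite -[b]mul1r -(smulVx _ a0) -mulrA ab0 mulr0.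
Qed.

Lemma waddA : associative wadd.
Proof. by move=> [a|] [b|] [c|] //=; rewrite addrA. Qed.
Lemma waddC : commutative wadd.
Proof. by move=> [a|] [b|] //=; rewrite addrC. Qed.
Lemma wadd0 : left_id (Fin 0) wadd.
Proof. by move=> [a|] //=; rewrite add0r. Qed.

HB.instance Definition _ :=
  GRing.isNmodule.Build (withtop X) waddA waddC wadd0.

Lemma wmulC : commutative wmul.
Proof. by move=> [a|] [b|] //=; rewrite mulrC. Qed.
Lemma wmulA : associative wmul.
Proof.
move=> [a|] [b|] [c|] /=; first by rewrite mulrA.
- have [->|a0] := eqVneq a 0; have [->|b0] := eqVneq b 0;
    by rewrite /= ?mulr0 ?mul0r ?eqxx ?smul_eq0 ?(negbTE a0) ?(negbTE b0).
- have [->|a0] := eqVneq a 0; have [->|c0] := eqVneq c 0;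
    by rewrite /= ?mulr0 ?mul0r ?eqxx ?(negbTE a0) ?(negbTE c0).
- by case: (eqVneq a 0) => a0 //=; rewrite ?eqxx ?(negbTE a0).
- have [->|b0] := eqVneq b 0; have [->|c0] := eqVneq c 0;
    by rewrite /= ?mulr0 ?mul0r ?eqxx ?smul_eq0 ?(negbTE b0) ?(negbTE c0).
- by case: (eqVneq b 0) => b0 //=; rewrite ?eqxx ?(negbTE b0).
- by case: (eqVneq c 0) => c0 //=; rewrite ?eqxx ?(negbTE c0).
- by [].
Qed.
Lemma wmul1 : left_id (Fin 1) wmul.
Proof. by move=> [a|] //=; rewrite ?mul1r ?oner_eq0. Qed.
Lemma wmulDl : left_distributive wmul wadd.
Proof.
move=> [a|] [b|] [c|] /=; first by rewrite mulrDl.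
- rewrite sadd_eq0; case: (eqVneq a 0) => _; case: (eqVneq b 0) => _ //=;
    by rewrite addr0.
- have [->|c0] := eqVneq c 0; by rewrite /= ?mulr0 ?addr0.
- by case: (eqVneq a 0).
- have [->|c0] := eqVneq c 0; by rewrite /= ?mulr0 ?addr0.
- by case: (eqVneq b 0).
- by case: (eqVneq c 0) => _ //=; rewrite addr0.
- by [].
Qed.
Lemma wmul0 : left_zero (Fin 0) wmul.
Proof. by move=> [a|] /=; rewrite ?mul0r ?eqxx. Qed.
Lemma w1_neq0 : Fin (1 : X) != Fin 0 :> withtop X.
Proof. by apply/eqP => -[] /eqP; rewrite oner_eq0. Qed.

HB.instance Definition _ := GRing.Nmodule_isComNzSemiRing.Build (withtop X)
  wmulA wmulC wmul1 wmulDl wmul0 w1_neq0.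

Local Notation wle := (@sle (withtop X)).

Lemma wle_refl : reflexive wle.
Proof. by case=> [a|]; apply/eqP => //; congr Fin; rewrite saddxx. Qed.
Lemma wle_anti : antisymmetric wle.
Proof. by move=> x y /andP[/eqP xy /eqP yx]; rewrite -yx addrC. Qed.
Lemma wle_trans : transitive wle.
Proof.
by move=> y x z /eqP xy /eqP yz; apply/eqP; rewrite -{1}yz addrA xy.
Qed.
Lemma wle_total : total wle.
Proof. by move=> [a|] [b|] //; apply: sle_total. Qed.
Lemma wle_top x : wle x Infty.
Proof. by case: x. Qed.

HB.instance Definition _ := Order.Le_isPOrder.Build ring_display
  (withtop X) wle_refl wle_anti wle_trans.
HB.instance Definition _ :=
  Order.POrder_isTotal.Build ring_display (withtop X) wle_total.
HB.instance Definition _ :=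
  Order.hasTop.Build ring_display (withtop X) wle_top.

End WithTop.

Section Approximation.
Variable X : radicableSemifieldType.

Definition pinv (a : X) : X := if a == 0 then 0 else sinv a.

(* The value at [Infty] matters only for vectors with infinite entries. *)
Definition wpinv (x : withtop X) : withtop X :=
  if x is Fin a then Fin (pinv a) else 0.

(* x^- for a row or column vector x over X, resp. over its extension. *)
Definition conj_vec m n (x : 'M[X]_(m, n)) : 'M[X]_(n, m) :=
  (map_mx pinv x)^T.
Definition wconj_vec m n (x : 'M[withtop X]_(m, n)) : 'M[withtop X]_(n, m) :=
  (map_mx wpinv x)^T.

Definition ext_mx m n (A : 'M[X]_(m, n)) : 'M[withtop X]_(m, n) :=
  map_mx Fin A.

Definition row_regular m n (A : 'M[X]_(m, n)) : bool :=
  [forall i, row i A != 0].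
Definition col_regular m n (A : 'M[X]_(m, n)) : bool :=
  [forall j, col j A != 0].

Definition in_span m n (A : 'M[X]_(m, n)) (a : 'cV[X]_m) : Prop :=
  exists x : 'I_n -> X, a = \sum_(j < n) x j *: col j A.

Definition supp (R : nmodType) m (a : 'cV[R]_m) : {set 'I_m} :=
  [set i | a i 0 != 0].

(* Defined on vectors over the extension, since the point at which the
   minimum is attained has infinite entries when the residual is infinite. *)
Definition wrho m (a b : 'cV[withtop X]_m) : withtop X :=
  if (a == 0) && (b == 0) then 1
  else if supp a == supp b
  then (wconj_vec b *m a) 0 0 + (wconj_vec a *m b) 0 0
  else Infty.

Definition rho m (a b : 'cV[X]_m) : withtop X := wrho (ext_mx a) (ext_mx b).

(* v = min {f x : P x}; in particular the minimum exists. *)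
Definition is_min (T : Type) (P : T -> Prop) (f : T -> withtop X)
    (v : withtop X) : Prop :=
  (exists2 x, P x & f x = v) /\ (forall x, P x -> v <= f x).

Definition is_dist m (S : 'cV[X]_m -> Prop) (d : 'cV[X]_m) (v : withtop X) :=
  is_min S (fun a => rho a d) v.

Definition zero_entries m (d : 'cV[X]_m) : {set 'I_m} := [set i | d i 0 == 0].
Definition active_cols m n (A : 'M[X]_(m, n)) (d : 'cV[X]_m) : {set 'I_n} :=
  [set j | [exists i in zero_entries d, slt 0 (A i j)]].
Definition consistent m n (A : 'M[X]_(m, n)) (d : 'cV[X]_m) : Prop :=
  forall i j, i \notin zero_entries d -> j \in active_cols A d -> A i j = 0.

Definition residual m n (A : 'M[X]_(m, n)) (d : 'cV[X]_m) : withtop X :=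
  if row_regular A then
    Fin (spow
      ((conj_vec (A *m conj_vec (conj_vec d *m A)) *m d) 0 0) (1 / 2))
  else Infty.

Definition full_vec m (x : 'cV[X]_m) : Prop := forall i, x i 0 != 0.

Definition best_point m n (A : 'M[X]_(m, n)) (d : 'cV[X]_m) :
    'cV[withtop X]_n :=
  residual A d *: ext_mx (conj_vec (conj_vec d *m A)).

End Approximation.

(* Main.v *)
Require Import Defs.
From mathcomp Require Import all_boot all_order all_algebra.

Set Implicit Arguments.
Unset Strict Implicit.
Unset Printing Implicit Defensive.

Import Order.TTheory GRing.Theory.
Local Open Scope ring_scope.

(** Put u = (d^- A)^-.  If Ax and d have the same support and theta is their
    distance, then d^- A x <= theta gives x <= theta u, hence
    A x <= theta A u; inverting and multiplying by d,
    (A u)^- d <= theta (A x)^- d <= theta^2, that is, Delta <= theta.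
    At x = Delta u both terms of the distance equal Delta.  Consistency and
    regularity serve to control supports: they yield supp (A u) = supp d, and
    they force x_j = 0 wherever u_j = 0. *)

(** * Order and inverses in a linearly ordered idempotent semifield *)

Section Semifield.
Variable X : radicableSemifieldType.
Implicit Types a b c x y : X.

Lemma sle_refl x : sle x x.
Proof. by rewrite /sle saddxx. Qed.

Lemma sle_trans y x z : sle x y -> sle y z -> sle x z.
Proof. by move=> /eqP xy /eqP yz; rewrite /sle -yz addrA xy. Qed.

Lemma sle_anti x y : sle x y -> sle y x -> x = y.
Proof. by move=> /eqP xy /eqP yx; rewrite -xy addrC yx. Qed.

Lemma sle0x x : sle 0 x.
Proof. by rewrite /sle add0r. Qed.

Lemma slt0x x : slt 0 x = (x != 0).
Proof. by rewrite /slt sle0x andbT eq_sym. Qed.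

Lemma sle_addl x y : sle x (x + y).
Proof. by rewrite /sle addrA saddxx. Qed.

Lemma sle_addr x y : sle y (x + y).
Proof. by rewrite addrC sle_addl. Qed.

Lemma sle_mul2l a x y : sle x y -> sle (a * x) (a * y).
Proof. by move=> /eqP xy; rewrite /sle -mulrDr xy. Qed.

Lemma sle_mul a b x y : sle a b -> sle x y -> sle (a * x) (b * y).
Proof.
move=> ab xy; apply: (@sle_trans (a * y)); first exact: sle_mul2l.
by rewrite ![_ * y]mulrC sle_mul2l.
Qed.

Lemma sle_sum (I : finType) (F : I -> X) y :
  (forall i, sle (F i) y) -> sle (\sum_i F i) y.
Proof.
move=> Fy; elim/big_ind: _ => //; first exact: sle0x.
by move=> a b /eqP ay /eqP yb; rewrite /sle -addrA yb ay.
Qed.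

Lemma sle_term (I : finType) (F : I -> X) i : sle (F i) (\sum_j F j).
Proof. by rewrite (bigD1 i) //= sle_addl. Qed.

(** Idempotent sums have no cancellation: each term lies below the sum, and [0] is the least
    element. All support arguments below rest on this. *)
Lemma ssum_eq0 (I : finType) (F : I -> X) i : \sum_j F j = 0 -> F i = 0.
Proof.
by move=> F0; apply: sle_anti (sle0x _); rewrite -F0; apply: sle_term.
Qed.

Lemma ssum_neq0 (I : finType) (F : I -> X) i : F i != 0 -> \sum_j F j != 0.
Proof. by apply: contra => /eqP /(ssum_eq0 i) ->. Qed.

Lemma smul_neq0 a b : a != 0 -> b != 0 -> a * b != 0.
Proof. by rewrite smul_eq0 negb_or => -> ->. Qed.

Lemma pinv0 : pinv (0 : X) = 0.
Proof. by rewrite /pinv eqxx. Qed.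

Lemma mulpVx a : a != 0 -> pinv a * a = 1.
Proof. by move=> a0; rewrite /pinv (negbTE a0) smulVx. Qed.

Lemma mulpxV a : a != 0 -> a * pinv a = 1.
Proof. by rewrite mulrC; apply: mulpVx. Qed.

Lemma pinv_eq0 a : (pinv a == 0) = (a == 0).
Proof.
have [->|a0] := eqVneq a 0; first by rewrite pinv0 eqxx.
by apply/negbTE/eqP => a'0; case/eqP: (oner_neq0 X);
  rewrite -(mulpVx a0) a'0 mul0r.
Qed.

Lemma conj_vecE m n (x : 'M[X]_(m, n)) i j : conj_vec x i j = pinv (x j i).
Proof. by rewrite !mxE. Qed.

Lemma smulIx c a b : c != 0 -> c * a = c * b -> a = b.
Proof.
by move=> c0 /(congr1 ( *%R (pinv c))); rewrite !mulrA mulpVx // !mul1r.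
Qed.

Lemma pinvM a b : pinv (a * b) = pinv a * pinv b.
Proof.
have [->|a0] := eqVneq a 0; first by rewrite mul0r pinv0 mul0r.
have [->|b0] := eqVneq b 0; first by rewrite mulr0 pinv0 mulr0.
have ab0 := smul_neq0 a0 b0.
by apply: (smulIx ab0); rewrite mulpxV // mulrACA !mulpxV ?mul1r.
Qed.

Lemma conj_vecZ m n c (x : 'M[X]_(m, n)) :
  conj_vec (c *: x) = pinv c *: conj_vec x.
Proof. by apply/matrixP => i j; rewrite !mxE pinvM. Qed.

(** By totality it remains to treat [b] below [a]. Then a a <= b b <= a b <= a a, and cancelling a
    nonzero [a] gives [a = b]. *)
Lemma sle_sqr a b : sle (a * a) (b * b) -> sle a b.
Proof.
move=> aabb; have /orP[//|ba] := sle_total a b.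
have [->|a0] := eqVneq a 0; first exact: sle0x.
suff -> : a = b by apply: sle_refl.
apply: (smulIx a0); apply: sle_anti; last exact: sle_mul2l.
by apply: sle_trans aabb _; apply: sle_mul (sle_refl _).
Qed.

(** The exponents add up to [1 / 2 + 1 / 2], which computes to [1] in [rat]. *)
Lemma spow_half a : a != 0 -> spow a (1 / 2) * spow a (1 / 2) = a.
Proof. by move=> a0; rewrite -spowD //; apply: spow1. Qed.

End Semifield.

(** * The embedding into the extension by [Infty], and the distance between finite vectors *)

Section Extension.
Variable X : radicableSemifieldType.

Lemma Fin_inj : injective (@Fin X).
Proof. by move=> a b []. Qed.

Lemma Fin_eq0 (a : X) : (Fin a == 0) = (a == 0).
Proof. by apply/eqP/eqP => [[]|->]. Qed.

Lemma le_Fin (a b : X) : (Fin a <= Fin b) = sle a b.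
Proof. by apply/eqP/eqP => [[]|e] //; congr Fin. Qed.

Lemma Fin_sum (I : finType) (F : I -> X) :
  Fin (\sum_i F i) = \sum_i Fin (F i).
Proof. exact: (big_morph (@Fin X) (id1 := 0) (op1 := +%R)). Qed.

Lemma ext_mxM m n p (A : 'M[X]_(m, n)) (B : 'M[X]_(n, p)) :
  ext_mx (A *m B) = ext_mx A *m ext_mx B.
Proof.
apply/matrixP => i j; rewrite !mxE Fin_sum.
by apply: eq_bigr => k _; rewrite !mxE.
Qed.

Lemma ext_mxZ m n c (A : 'M[X]_(m, n)) :
  ext_mx (c *: A) = Fin c *: ext_mx A.
Proof. by apply/matrixP => i j; rewrite !mxE. Qed.

Lemma wconj_ext m n (A : 'M[X]_(m, n)) :
  wconj_vec (ext_mx A) = ext_mx (conj_vec A).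
Proof. by apply/matrixP => i j; rewrite !mxE. Qed.

Lemma ext_mx_eq0 m n (A : 'M[X]_(m, n)) : (ext_mx A == 0) = (A == 0).
Proof.
apply/eqP/eqP => [/matrixP A0|->]; apply/matrixP => i j; last by rewrite !mxE.
by apply: Fin_inj; move: (A0 i j); rewrite !mxE.
Qed.

Lemma supp_ext m (a : 'cV[X]_m) : supp (ext_mx a) = supp a.
Proof. by apply/setP => i; rewrite !inE mxE Fin_eq0. Qed.

Lemma supp_eq0 m (a b : 'cV[X]_m) :
  supp a = supp b -> forall i, (a i 0 == 0) = (b i 0 == 0).
Proof.
by move=> /setP ab i; apply: negb_inj; move: (ab i); rewrite !inE.
Qed.

Lemma wrho_supp_neq m (a b : 'cV[withtop X]_m) :
  supp a != supp b -> wrho a b = Infty.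
Proof.
move=> ab; rewrite /wrho (negbTE ab).
by case: ifP ab => // /andP[/eqP-> /eqP->]; rewrite eqxx.
Qed.

Lemma rho_supp_eq m (a b : 'cV[X]_m) : b != 0 -> supp a = supp b ->
  rho a b = Fin ((conj_vec b *m a) 0 0 + (conj_vec a *m b) 0 0).
Proof.
move=> b0 ab.
rewrite /rho /wrho !ext_mx_eq0 (negbTE b0) andbF !supp_ext ab eqxx.
by rewrite !wconj_ext -!ext_mxM !mxE.
Qed.

End Extension.

(** * Control of supports through regularity and consistency *)

Section Residual.
Variables (X : radicableSemifieldType) (m n : nat).
Variables (A : 'M[X]_(m, n)) (d : 'cV[X]_m).

Lemma in_spanP a : in_span A a <-> exists x : 'cV[X]_n, a = A *m x.
Proof.
split=> [[x ->]|[x ->]].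
  exists (\col_j x j); apply/colP => i; rewrite mxE summxE.
  by apply: eq_bigr => j _; rewrite !mxE mulrC.
exists (fun j => x j 0); apply/colP => i; rewrite mxE summxE.
by apply: eq_bigr => j _; rewrite !mxE mulrC.
Qed.

(** Entry [i] of the product vanishes, even at infinite entries of [x] since [0] times [Infty] is
    [0], so the supports differ. Entries in the extension are allowed in order to cover
    [best_point]. *)
Lemma zero_row_rho (x : 'cV[withtop X]_n) i :
  row i A = 0 -> d i 0 != 0 -> wrho (ext_mx A *m x) (ext_mx d) = Infty.
Proof.
move=> Ai0 di0; apply: wrho_supp_neq; apply/eqP => /setP /(_ i).
rewrite supp_ext !inE di0 mxE big1 ?eqxx // => j _; rewrite mxE.
by move/rowP: Ai0 => /(_ j); rewrite !mxE => ->; rewrite mul0r.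
Qed.

Hypothesis A_col_regular : col_regular A.
Hypothesis A_d_consistent : consistent A d.

Local Notation w := (conj_vec d *m A).
Local Notation u := (conj_vec w).

Lemma col_regularP j : exists i, A i j != 0.
Proof.
move/forallP: A_col_regular => /(_ j) Aj; apply/existsP.
apply: contraR Aj => /existsPn A0.
by apply/eqP/colP => i; rewrite !mxE; apply/eqP; move: (A0 i); rewrite negbK.
Qed.

Lemma row_regularP i : row_regular A -> exists j, A i j != 0.
Proof.
move=> /forallP /(_ i) Ai; apply/existsP; apply: contraR Ai => /existsPn A0.
by apply/eqP/rowP => j; rewrite !mxE; apply/eqP; move: (A0 j); rewrite negbK.
Qed.

Lemma w_neq0 i j : d i 0 != 0 -> A i j != 0 -> w 0 j != 0.
Proof.
move=> di0 Aij0; rewrite mxE; apply: (@ssum_neq0 _ _ _ i).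
by rewrite !mxE smul_neq0 // pinv_eq0.
Qed.

Lemma consistent_block i k j :
  d i 0 != 0 -> d k 0 = 0 -> A k j != 0 -> A i j = 0.
Proof.
move=> di0 dk0 Akj; apply: A_d_consistent; rewrite inE //.
by apply/existsP; exists k; rewrite inE dk0 eqxx slt0x.
Qed.

(** Column regularity yields a nonzero [A i j]; were [d i 0] nonzero, this entry would make [w 0 j]
    nonzero. Conversely, a column meeting a zero row of [d] vanishes on the other rows by
    consistency, while on the zero rows the factor from [conj_vec d] is [0]. *)
Lemma w_eq0 j : (w 0 j == 0) = [exists i, (d i 0 == 0) && (A i j != 0)].
Proof.
apply/eqP/existsP => [w0|[k /andP[/eqP dk0 Akj]]].
  have [i Aij] := col_regularP j; exists i; rewrite Aij andbT.
  by apply: contraT => di0; move: (w_neq0 di0 Aij); rewrite w0 eqxx.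
rewrite mxE big1 // => i _; rewrite !mxE.
have [->|di0] := eqVneq (d i 0) 0; first by rewrite pinv0 mul0r.
by rewrite (consistent_block di0 dk0 Akj) mulr0.
Qed.

Lemma full_conj : full_vec d -> full_vec u.
Proof.
move=> d_full j; have [i Aij] := col_regularP j.
by rewrite conj_vecE pinv_eq0 (w_neq0 (d_full i) Aij).
Qed.

Hypothesis A_row_regular : row_regular A.

(** On a zero row of [d], a nonzero [A i j] forces [w 0 j = 0], hence [u j 0 = 0] by the convention
    [pinv 0 = 0]. On any other row, row regularity supplies a nonzero term. *)
Lemma Au_eq0 i : ((A *m u) i 0 == 0) = (d i 0 == 0).
Proof.
have [di0|di0] := eqVneq (d i 0) 0.
  apply/eqP; rewrite mxE big1 // => j _; rewrite conj_vecE.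
  have [->|Aij] := eqVneq (A i j) 0; first by rewrite mul0r.
  suff /eqP-> : w 0 j == 0 by rewrite pinv0 mulr0.
  by rewrite w_eq0; apply/existsP; exists i; rewrite di0 eqxx.
have [j Aij] := row_regularP i A_row_regular.
apply/negbTE; rewrite mxE; apply: (@ssum_neq0 _ _ _ j).
by rewrite conj_vecE smul_neq0 // pinv_eq0 (w_neq0 di0 Aij).
Qed.

Hypothesis d_neq0 : d != 0.

Lemma cV_neq0P : exists i, d i 0 != 0.
Proof.
apply/existsP; apply: contraR d_neq0 => /existsPn d0.
by apply/eqP/colP => i; rewrite mxE; apply/eqP; move: (d0 i); rewrite negbK.
Qed.

(** * The distance at [Delta *: u], and the lower bound at every point *)

Local Notation delta := ((conj_vec (A *m u) *m d) 0 0).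
Local Notation Delta := (spow delta (1 / 2)).

Lemma delta_neq0 : delta != 0.
Proof.
have [i di0] := cV_neq0P; rewrite mxE; apply: (@ssum_neq0 _ _ _ i).
by rewrite conj_vecE smul_neq0 // pinv_eq0 Au_eq0.
Qed.

Lemma Delta_neq0 : Delta != 0.
Proof.
by apply/eqP => D0; move: delta_neq0;
  rewrite -(spow_half delta_neq0) D0 mul0r eqxx.
Qed.

Lemma u_neq0 : u != 0.
Proof.
have [i di0] := cV_neq0P; have [j Aij] := row_regularP i A_row_regular.
apply/eqP => /colP /(_ j); rewrite conj_vecE [RHS]mxE => /eqP.
by rewrite pinv_eq0 (negbTE (w_neq0 di0 Aij)).
Qed.

(** Each term is [1] or [0] according to whether [w 0 k] is nonzero, at least one is [1], and the
    sum is idempotent. *)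
Lemma wu1 : (w *m u) 0 0 = 1.
Proof.
have [i di0] := cV_neq0P; have [j Aij] := row_regularP i A_row_regular.
have wj0 := w_neq0 di0 Aij.
apply: sle_anti.
  rewrite mxE; apply: sle_sum => k; rewrite conj_vecE.
  have [->|wk0] := eqVneq (w 0 k) 0; first by rewrite mul0r sle0x.
  by rewrite mulpxV // sle_refl.
rewrite -(mulpxV wj0) -conj_vecE [(w *m u) _ _]mxE.
exact: (sle_term (fun k => w 0 k * u k 0)).
Qed.

Lemma rho_Delta_u : rho (A *m (Delta *: u)) d = Fin Delta.
Proof.
rewrite -scalemxAr rho_supp_eq //; last first.
  apply/setP => i; rewrite !inE mxE smul_eq0 (negbTE Delta_neq0) /=.
  by rewrite Au_eq0.
have scaleE c (M : 'M[X]_1) : (c *: M) 0 0 = c * M 0 0 by rewrite mxE.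
rewrite conj_vecZ -scalemxAr mulmxA -scalemxAl !scaleE wu1 mulr1.
(* The first term is already [Delta]; writing [delta] as a square lets [pinv Delta] cancel one
   factor, so the second is [Delta] too. *)
rewrite -[X in pinv _ * X](spow_half delta_neq0).
by rewrite mulrA mulpVx ?mul1r ?saddxx ?Delta_neq0.
Qed.

Lemma Delta_le_rho (x : 'cV[X]_n) : Fin Delta <= rho (A *m x) d.
Proof.
have [Axd|Axd] := eqVneq (supp (A *m x)) (supp d); last first.
  by rewrite /rho wrho_supp_neq ?supp_ext // wle_top.
rewrite rho_supp_eq // le_Fin; set t := _ + _.
have Ax_eq0 := supp_eq0 Axd.
(* If [w 0 j = 0], column [j] has a nonzero entry in a row where [d], hence [A *m x], vanishes, so
   [x j 0 = 0]. Otherwise the bound w_j x_j <= t is divided by w_j. *)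
have xu j : sle (x j 0) (t * u j 0).
  rewrite conj_vecE; have [wj0|wj0] := eqVneq (w 0 j) 0.
    move/eqP: (wj0); rewrite w_eq0 => /existsP[i /andP[di0 Aij]].
    move: di0; rewrite -Ax_eq0 mxE => /eqP /(ssum_eq0 j) /eqP.
    by rewrite smul_eq0 (negbTE Aij) => /eqP->; rewrite sle0x.
  rewrite -[x j 0]mul1r -(mulpVx wj0) -mulrA [t * _]mulrC; apply: sle_mul2l.
  apply: sle_trans (sle_addl _ _); rewrite mulmxA [X in sle _ X]mxE.
  exact: (sle_term (fun k => w 0 k * x k 0)).
have Axu i : sle ((A *m x) i 0) (t * (A *m u) i 0).
  rewrite mxE; apply: sle_sum => j.
  apply: (@sle_trans _ (t * (A i j * u j 0))); last first.
    rewrite [(A *m u) i 0]mxE; apply: sle_mul2l.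
    exact: (sle_term (fun k => A i k * u k 0)).
  by rewrite mulrCA; apply: sle_mul2l.
(* Squaring removes the root: it suffices to bound each term of [delta] by [t * t]. *)
apply: sle_sqr; rewrite spow_half ?delta_neq0 // mxE; apply: sle_sum => i.
rewrite conj_vecE.
have [->|di0] := eqVneq (d i 0) 0; first by rewrite mulr0 sle0x.
set p := (A *m u) i 0; set q := (A *m x) i 0.
have p0 : p != 0 by rewrite Au_eq0.
have q0 : q != 0 by rewrite Ax_eq0.
have qdt : sle (pinv q * d i 0) t.
  apply: sle_trans (sle_addr _ _); rewrite [X in sle _ X]mxE.
  rewrite -conj_vecE.
  exact: (sle_term (fun k => conj_vec (A *m x) 0 k * d k 0)).
apply: (@sle_trans _ (t * (pinv q * d i 0))); last exact: sle_mul2l.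
(* The multiplier turns q <= t p into p^-1 d_i <= t q^-1 d_i, since it cancels [q] on the left and
   [p] on the right. *)
have := sle_mul2l (pinv p * (pinv q * d i 0)) (Axu i); rewrite -/p -/q.
rewrite -mulrA -[X in sle (_ * X) _]mulrA [d i 0 * q]mulrC.
rewrite [pinv q * (q * _)]mulrA mulpVx // mul1r.
rewrite [X in sle _ X]mulrC -[X in sle _ X]mulrA.
by rewrite [p * _]mulrA mulpxV // mul1r.
Qed.

End Residual.

(** The clause on full vectors is guarded because, for row regular [A], a zero entry of [d] makes
    the supports of [A *m x] and [d] differ for every full [x]. The hypothesis [zero_row] puts some
    zero row inside the support of [d]: with zero rows only outside it, the distance could be finite
    although the residual is [Infty]. Positivity of [n] ensures that nonzero vectors exist. *)
Theorem theorem1 (X : radicableSemifieldType) (m n : nat)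
    (A : 'M[X]_(m, n)) (d : 'cV[X]_m)
    (n_gt0 : (0 < n)%N)
    (A_col_regular : col_regular A)
    (d_neq0 : d != 0)
    (A_d_consistent : consistent A d)
    (zero_row : ~~ row_regular A -> exists2 i, row i A = 0 & d i 0 != 0) :
  let Delta := residual A d in
  [/\ is_dist (in_span A) d Delta,
      is_min (fun x : 'cV[X]_n => x != 0) (fun x => rho (A *m x) d) Delta,
      (full_vec d \/ Delta = Infty ->
         is_min (@full_vec X n) (fun x => rho (A *m x) d) Delta),
      wrho (ext_mx A *m best_point A d) (ext_mx d) = Delta
    & (Delta <> Infty ->
         exists x : 'cV[X]_n, [/\ ext_mx x = best_point A d, x != 0
           & full_vec d -> full_vec x])].
Proof.
rewrite /= /best_point /residual; case: ifPn => [A_row_regular|/zero_row].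
  set Delta := spow _ _; set u := conj_vec (conj_vec d *m A).
  have D0 : Delta != 0 by apply: Delta_neq0.
  have Du0 : Delta *: u != 0.
    have := u_neq0 A_row_regular d_neq0; apply: contra => /eqP Du.
    apply/eqP/colP => j; apply: (smulIx D0).
    by move/colP: Du => /(_ j); rewrite !mxE mulr0.
  have full_Du : full_vec d -> full_vec (Delta *: u).
    move=> /(full_conj A_col_regular) u_full j.
    by rewrite mxE smul_neq0 // u_full.
  have rhoDu : rho (A *m (Delta *: u)) d = Fin Delta by apply: rho_Delta_u.
  have D_le x : Fin Delta <= rho (A *m x) d by apply: Delta_le_rho.
  split.
  - split; first by exists (A *m (Delta *: u)) => //;
      apply/in_spanP; exists (Delta *: u).
    by move=> _ /in_spanP[x ->].
  - by split=> //; exists (Delta *: u).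
  - by case=> // d_full; split=> //; exists (Delta *: u) => //; apply: full_Du.
  - by rewrite -ext_mxZ -ext_mxM.
  - by move=> _; exists (Delta *: u); split=> //; rewrite ext_mxZ.
move=> [i Ai0 di0].
have rho_top (x : 'cV[X]_n) : rho (A *m x) d = Infty.
  by rewrite /rho ext_mxM (zero_row_rho _ Ai0 di0).
(* Every distance is now [Infty], so any admissible point is a minimizer; the all-ones vector is
   both full and nonzero. *)
have full1 : full_vec (const_mx 1 : 'cV[X]_n).
  by move=> j; rewrite mxE oner_neq0.
have neq1 : (const_mx 1 : 'cV[X]_n) != 0.
  by apply/eqP => /colP /(_ (Ordinal n_gt0)) /eqP; apply/negP;
    rewrite [X in _ == X]mxE full1.
split=> //.
- split; first by exists (A *m const_mx 1) => //;
      apply/in_spanP; exists (const_mx 1).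
  by move=> _ /in_spanP[x ->]; rewrite rho_top.
- by split=> [|x _]; [exists (const_mx 1) | rewrite rho_top].
- by split=> [|x _]; [exists (const_mx 1) | rewrite rho_top].
- exact: zero_row_rho Ai0 di0.
Qed.
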